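(* Suppose the standing assumptions (A1)–(A6) hold, that the parameters satisfy $\frac{\sqrt5-1}{2}\le\eta<1$, $0<\gamma<\frac1\tau$ and $0<\alpha\le\frac{1}{2(\gamma\tau^2+L+\tau)\eta}$, and that $G$ is monotone on $\mathbf U$. Let the sequence $\{(v^k,u^k,p^k)\}$ be generated by ALAVI, and for any integer $t>0$ let $\tilde u_t=\frac1t\sum_{k=1}^tu^k$, $\tilde p_t=\frac1t\sum_{k=1}^tq^k$. Then there exists $\tilde\rho>0$ such that, for every integer $t>0$, $$\psi(\tilde u_t,\tilde p_t)\le\frac{\tilde\rho}{t}.$$
   Context: Setting. $G:\mathbb R^n\to\mathbb R^n$ is continuous; $\mathbf U\subseteq\mathbb R^n$ is a closed convex set; $J$ is a continuous function on $\mathbf U$, possibly nonsmooth; $\Theta:\mathbb R^n\to\mathbb R^m$ is continuous; $\mathbf C\subseteq\mathbb R^m$ is a nonempty closed convex cone with dual cone $\mathbf C^*=\{q\in\mathbb R^m:\langle q,\theta\rangle\ge0\ \forall\theta\in\mathbf C\}$; $\Pi$ is the projection onto $\mathbf C^*$. Let $\Gamma=\{u\in\mathbf U:\Theta(u)\in-\mathbf C\}$. Problem (VIP): find $u^*\in\Gamma$ with $\langle G(u^* ),u-u^*\rangle+J(u)-J(u^* )\ge0$ for all $u\in\Gamma$. Standing assumptions. (A1) (VIP) has a solution. (A2) $G$ is $L$-Lipschitz on $\mathbf U$. (A3) $J$ is proper, convex and lower semicontinuous (not necessarily differentiable). (A4) $\Theta$ is $\mathbf C$-convex: $\Theta(au+(1-a)v)-a\Theta(u)-(1-a)\Theta(v)\in-\mathbf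 C$ for all $u,v\in\mathbf U$, $a\in[0,1]$. (A5) $\Theta$ is Lipschitz with constant $\tau$ on an open set $\mathcal O\supseteq\mathbf U$. (A6) If $\operatorname{int}\mathbf C\ne\emptyset$ then $\Theta(\mathbf U)\cap(-\operatorname{int}\mathbf C)\neq\emptyset$; if $\mathbf C=\{0\}$ then $0\in\operatorname{int}\Theta(\mathbf U)$. $G$ is monotone on $\mathbf U$ if $\langle G(u)-G(v),u-v\rangle\ge0$ for all $u,v\in\mathbf U$. Algorithm ALAVI. Input: $u^1,v^0\in\mathbb R^n$, $p^0\in\mathbb R^m$, and parameters $0<\eta<1$, $\alpha>0$, $\gamma>0$; set $k=1$. Iteration $k$: $v^k=(1-\eta)u^k+\eta v^{k-1}$; $q^k=\Pi(p^k+\gamma\Theta(u^k))$; $u^{k+1}=\arg\min_{u\in\mathbf U}\{\langle G(u^k),u\rangle+J(u)+\langle q^k,\Theta(u)\rangle+\frac1{2\alpha}\|u-v^k\|^2\}$; $p^{k+1}=\Pi(p^k+\gamma\Theta(u^{k+1}))$; then $k$ is increased by 1. (The input list is the one given in the source; it does not further specify $p^1$.) Put $w^k=(v^k,u^k,p^k)$. Gap function. Under the stated hypotheses the sequence $\{w^k\}$ is bounded, so there is $\tilde r>0$ with $\|w^k\|\le\tilde r$ for all $k\in\mathbb N$; set $r=(2\gamma\tau+1)\tilde r$. Let $\mathfrak B_u(r)\subset\mathbb R^n$ and $\mathfrak B_p(r)\subset\mathbb R^m$ be the balls of radius $r$ centered at the origin; then $u^k\in\mathfrak B_u(r)$ and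 $q^k\in\mathfrak B_p(r)$ for all $k$. Define $\Psi(u,p,\zeta,\lambda)=\langle G(\zeta),u-\zeta\rangle+J(u)-J(\zeta)+\langle\lambda,\Theta(u)\rangle-\langle p,\Theta(\zeta)\rangle$ and $$\psi(u,p)=\max_{(\zeta,\lambda)\in(\mathbf U\cap\mathfrak B_u(r))\times(\mathbf C^*\cap\mathfrak B_p(r))}\Psi(u,p,\zeta,\lambda).$$
   Formalization: The formal statement adds that J is finite at u^1 (otherwise ψ at t=1 is infinite or undefined); boundedness of {w^k} is proved when int C is nonempty or C={0}, and for other cones the rate is stated for any bound r~ of {w^k}, since there (A6) is void and boundedness can fail. *)

(* Defs.v *)
From HB Require Import structures.
From mathcomp Require Import all_boot all_order all_algebra.
From mathcomp Require Import all_classical all_reals all_analysis.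

Set Implicit Arguments.
Unset Strict Implicit.
Unset Printing Implicit Defensive.

Import Order.TTheory GRing.Theory Num.Theory.
Import numFieldNormedType.Exports.

Local Open Scope classical_set_scope.
Local Open Scope ring_scope.

(* Vectors of R^n are row vectors. The
   norm that the library puts on 'rV[R]_n is the maximum norm, so the Euclidean
   inner product and norm are defined here; the library topology on 'rV[R]_n is
   the usual one. *)

Section Euclidean.
Context {R : realType}.

Definition dot n (x y : 'rV[R]_n) : R := \sum_(i < n) x 0 i * y 0 i.

Definition enorm n (x : 'rV[R]_n) : R := Num.sqrt (dot x x).

Definition eball n (r : R) : set 'rV[R]_n := [set x | enorm x <= r].

Definition elipschitz n m (A : set 'rV[R]_n) (k : R)
    (f : 'rV[R]_n -> 'rV[R]_m) : Prop :=
  forall x y, A x -> A y -> enorm (f x - f y) <= k * enorm (x - y).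

Definition is_proj n (K : set 'rV[R]_n) (x y : 'rV[R]_n) : Prop :=
  K y /\ forall z, K z -> enorm (x - y) <= enorm (x - z).

End Euclidean.

Section Convexity.
Context {R : realType}.

Definition is_argmin n (U : set 'rV[R]_n) (F : 'rV[R]_n -> \bar R)
    (y : 'rV[R]_n) : Prop :=
  U y /\ forall x, U x -> (F y <= F x)%E.

Definition is_cone m (C : set 'rV[R]_m) : Prop :=
  forall (a : R) x, 0 < a -> C x -> C (a *: x).

Definition dual_cone m (C : set 'rV[R]_m) : set 'rV[R]_m :=
  [set q | forall x, C x -> 0 <= dot q x].

Definition proper_fun n (J : 'rV[R]_n -> \bar R) : Prop :=
  (forall x, -oo < J x)%E /\ exists x, (J x < +oo)%E.

Definition econvex n (J : 'rV[R]_n -> \bar R) : Prop :=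
  forall x y (a : R), 0 <= a <= 1 ->
    (J (a *: x + (1 - a) *: y)%R <= a%:E * J x + (1 - a)%:E * J y)%E.

(* z \in - C is written C (- z). *)
Definition cone_convex n m (U : set 'rV[R]_n) (C : set 'rV[R]_m)
    (Theta : 'rV[R]_n -> 'rV[R]_m) : Prop :=
  forall u v (a : R), U u -> U v -> 0 <= a <= 1 ->
    C (- (Theta (a *: u + (1 - a) *: v) - a *: Theta u - (1 - a) *: Theta v)).

Definition monotone_on n (U : set 'rV[R]_n) (G : 'rV[R]_n -> 'rV[R]_n) : Prop :=
  forall u v, U u -> U v -> 0 <= dot (G u - G v) (u - v).

End Convexity.

(* J is extended-real valued, J : R^n -> ]-oo, +oo]; a function given only on U
   is extended by +oo. It is assumed finite on U wherever these notions are
   used, so that no difference +oo - +oo of values of J occurs. *)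
Section Problem.
Context {R : realType} {n m : nat}.
Variables (U : set 'rV[R]_n) (C : set 'rV[R]_m).
Variables (G : 'rV[R]_n -> 'rV[R]_n) (J : 'rV[R]_n -> \bar R).
Variable Theta : 'rV[R]_n -> 'rV[R]_m.

Definition feasible : set 'rV[R]_n := [set u | U u /\ C (- Theta u)].

Definition vip_solution (us : 'rV[R]_n) : Prop :=
  feasible us /\
  forall u, feasible u -> (0 <= (dot (G us) (u - us)%R)%:E + J u - J us)%E.

Definition constraint_qualification : Prop :=
  (interior C !=set0 -> exists u, U u /\ interior C (- Theta u)) /\
  (C = [set 0] -> interior (Theta @` U) 0).

(* The iteration for k >= 1. The inputs are u 1, v 0, p 0; p 1 is arbitrary,
   u 0 and q 0 play no role. *)
Definition ALAVI (eta alpha gamma : R)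
    (v u : nat -> 'rV[R]_n) (p q : nat -> 'rV[R]_m) : Prop :=
  forall k, (0 < k)%N ->
  [/\ v k = (1 - eta) *: u k + eta *: v k.-1,
      is_proj (dual_cone C) (p k + gamma *: Theta (u k)) (q k),
      is_argmin U
        (fun x => (dot (G (u k)) x)%:E + J x + (dot (q k) (Theta x))%:E
                  + (1 / (2 * alpha) * enorm (x - v k) ^+ 2)%:E)%E
        (u k.+1) &
      is_proj (dual_cone C) (p k + gamma *: Theta (u k.+1)) (p k.+1)].

Definition Psi (u : 'rV[R]_n) (p : 'rV[R]_m) (zeta : 'rV[R]_n)
    (lambda : 'rV[R]_m) : \bar R :=
  ((dot (G zeta) (u - zeta)%R)%:E + J u - J zeta
   + (dot lambda (Theta u))%:E - (dot p (Theta zeta))%:E)%E.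

(* The maximum is rendered by the supremum in \bar R; it is attained for
   continuous data, the index set being then compact. *)
Definition psi (r : R) (u : 'rV[R]_n) (p : 'rV[R]_m) : \bar R :=
  ereal_sup [set Psi u p zl.1 zl.2 |
    zl in (U `&` eball r) `*` (dual_cone C `&` eball r)].

End Problem.

Section Iterates.
Context {R : realType} {n m : nat}.

Definition wnorm (v u : 'rV[R]_n) (p : 'rV[R]_m) : R :=
  Num.sqrt (enorm v ^+ 2 + enorm u ^+ 2 + enorm p ^+ 2).

Definition average (x : nat -> 'rV[R]_n) (t : nat) : 'rV[R]_n :=
  t%:R^-1 *: \sum_(1 <= k < t.+1) x k.

End Iterates.

(* Main.v *)
Require Import Defs.
From HB Require Import structures.
From mathcomp Require Import all_boot all_order all_algebra.
From mathcomp Require Import all_classical all_reals all_analysis.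
From mathcomp Require Import ring lra.

(* Adding the optimality condition of the step producing u^{k+1}, tested at an
   arbitrary z in U, to that of the previous step, tested at u^{k+1}, and the
   variational inequalities of the two dual projections, one gets for k >= 3 and
   (z, l) in U x C^* that
     Psi(u^k, q^k, z, l) <= E_k(z, l) - E_{k+1}(z, l),
   where E_k(z, l) = |v^k - z|^2 / (2 alpha (1 - eta)) + |p^{k-1} - l|^2 / (2 gamma)
   + (L + gamma tau^2) / 2 |u^k - u^{k-1}|^2; the condition on eta is
   eta^2 + eta >= 1, which makes the term in |u^{k+1} - v^k|^2 nonpositive.
   Summing and using Jensen's inequality gives the rate. At a saddle point the
   left side is nonnegative, so E_k decreases and the iterates are bounded; the
   multiplier comes from weak separation of 0 from the convex set
   {(s, Theta(u) + c) : s > <G(us), u - us> + J(u) - J(us), c in C}, us being a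
   solution of (VIP). *)

Set Implicit Arguments.
Unset Strict Implicit.
Unset Printing Implicit Defensive.

Import Order.TTheory GRing.Theory Num.Theory.
Import numFieldNormedType.Exports.

Local Open Scope classical_set_scope.
Local Open Scope ring_scope.

(** * Euclidean geometry of row vectors *)

Section EuclideanLemmas.
Context {R : realType}.
Implicit Types n m : nat.

Lemma dotC n (x y : 'rV[R]_n) : dot x y = dot y x.
Proof. by apply: eq_bigr => i _; rewrite mulrC. Qed.

Lemma dotDl n (x y z : 'rV[R]_n) : dot (x + y) z = dot x z + dot y z.
Proof. by rewrite /dot -big_split; apply: eq_bigr => i _; rewrite mxE mulrDl. Qed.

Lemma dotZl n a (x z : 'rV[R]_n) : dot (a *: x) z = a * dot x z.
Proof. by rewrite /dot mulr_sumr; apply: eq_bigr => i _; rewrite mxE mulrA. Qed.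

Lemma dotNl n (x z : 'rV[R]_n) : dot (- x) z = - dot x z.
Proof. by rewrite -scaleN1r dotZl mulN1r. Qed.

Lemma dotDr n (x y z : 'rV[R]_n) : dot z (x + y) = dot z x + dot z y.
Proof. by rewrite dotC dotDl !(dotC z). Qed.

Lemma dotZr n a (x z : 'rV[R]_n) : dot z (a *: x) = a * dot z x.
Proof. by rewrite dotC dotZl dotC. Qed.

Lemma dotNr n (x z : 'rV[R]_n) : dot z (- x) = - dot z x.
Proof. by rewrite dotC dotNl dotC. Qed.

Lemma dot0l n (x : 'rV[R]_n) : dot 0 x = 0.
Proof. by rewrite /dot big1 // => i _; rewrite mxE mul0r. Qed.

Lemma dot0r n (x : 'rV[R]_n) : dot x 0 = 0.
Proof. by rewrite dotC dot0l. Qed.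

Definition dotE := (dotDl, dotDr, dotNl, dotNr, dotZl, dotZr, dot0l, dot0r).

Lemma dot_suml n I (r : seq I) (F : I -> 'rV[R]_n) (y : 'rV[R]_n) :
  dot (\sum_(i <- r) F i) y = \sum_(i <- r) dot (F i) y.
Proof. by elim/big_rec2: _ => [|i a b _ <-]; rewrite ?dot0l ?dotDl. Qed.

Lemma dot_row_mx n m (a c : 'rV[R]_n) (b d : 'rV[R]_m) :
  dot (row_mx a b) (row_mx c d) = dot a c + dot b d.
Proof.
by rewrite /dot big_split_ord; congr (_ + _); apply: eq_bigr => i _;
  rewrite ?row_mxEl ?row_mxEr.
Qed.

Lemma dot_ge0 n (x : 'rV[R]_n) : 0 <= dot x x.
Proof. by apply: sumr_ge0 => i _; rewrite -expr2 sqr_ge0. Qed.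

Lemma dot_eq0 n (x : 'rV[R]_n) : dot x x = 0 -> x = 0.
Proof.
move=> /eqP; rewrite psumr_eq0 => [|i _]; last by rewrite -expr2 sqr_ge0.
move=> /allP h; apply/rowP => i; rewrite mxE.
by have := h i (mem_index_enum i); rewrite /= -expr2 sqrf_eq0 => /eqP.
Qed.

Lemma dot_gt0 n (x : 'rV[R]_n) : x != 0 -> 0 < dot x x.
Proof.
by move=> x0; rewrite lt_def dot_ge0 andbT; apply: contra_neq x0; exact: dot_eq0.
Qed.

Lemma enorm_ge0 n (x : 'rV[R]_n) : 0 <= enorm x.
Proof. exact: sqrtr_ge0. Qed.

Lemma enorm_sqr n (x : 'rV[R]_n) : enorm x ^+ 2 = dot x x.
Proof. by rewrite sqr_sqrtr // dot_ge0. Qed.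

(** Cauchy-Schwarz: the squared norm of [dot y y *: x - dot x y *: y] is [dot y y] times the
    difference of the two sides. *)
Lemma dot_sqr_le n (x y : 'rV[R]_n) : dot x y ^+ 2 <= dot x x * dot y y.
Proof.
have [->|y0] := eqVneq y 0; first by rewrite !dot0r expr0n mulr0.
have yy := dot_gt0 y0.
have := dot_ge0 (dot y y *: x - dot x y *: y).
rewrite !dotE (dotC y x).
rewrite (_ : _ + _ = dot y y * (dot x x * dot y y - dot x y ^+ 2)); last ring.
by rewrite pmulr_rge0 // subr_ge0.
Qed.

Lemma dot_le_enorm n (x y : 'rV[R]_n) : dot x y <= enorm x * enorm y.
Proof.
have xy0 : 0 <= enorm x * enorm y by rewrite mulr_ge0 // enorm_ge0.
case: (leP (dot x y) 0) => [h|h]; first exact: le_trans h xy0.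
by rewrite -ler_sqr ?nnegrE ?(ltW h) // exprMn !enorm_sqr dot_sqr_le.
Qed.

Lemma enormN n (x : 'rV[R]_n) : enorm (- x) = enorm x.
Proof. by rewrite /enorm !dotE opprK. Qed.

Lemma enorm0 n : enorm (0 : 'rV[R]_n) = 0.
Proof. by rewrite /enorm dot0l sqrtr0. Qed.

Lemma enormZ n a (x : 'rV[R]_n) : enorm (a *: x) = `|a| * enorm x.
Proof. by rewrite /enorm !dotE mulrA -expr2 sqrtrM ?sqr_ge0 // sqrtr_sqr. Qed.

Lemma ler_enormD n (x y : 'rV[R]_n) : enorm (x + y) <= enorm x + enorm y.
Proof.
rewrite -ler_sqr ?nnegrE ?addr_ge0 ?enorm_ge0 //.
rewrite sqrrD !enorm_sqr !dotE (dotC y x).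
have := dot_le_enorm x y; lra.
Qed.

Lemma ler_enormB n (x y : 'rV[R]_n) : enorm (x - y) <= enorm x + enorm y.
Proof. by rewrite -(enormN y) ler_enormD. Qed.

Lemma enormB n (x y : 'rV[R]_n) : enorm (x - y) = enorm (y - x).
Proof. by rewrite -enormN opprB. Qed.

(** Stands in for the limit a → 0: it turns minimality along a segment into a first-order inequality
    without derivatives. *)
Lemma ge0_of_perturbation (X Y : R) :
  (forall a, 0 < a <= 1 -> 0 <= X + a * Y) -> 0 <= X.
Proof.
move=> h; rewrite leNgt; apply/negP => X0.
have [Y0|Y0] := leP Y 0; first by have := h 1; lra.
(* For this [a] one has [a * Y <= - X / 2], so [X + a * Y] is at most [X / 2], which is negative. *)
have a0 : 0 < Num.min 1 (- X / (2 * Y)).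
  by rewrite lt_min ltr01 /= divr_gt0 //; lra.
have := h _ (_ : 0 < Num.min 1 (- X / (2 * Y)) <= 1).
rewrite a0 ge_min lexx /= => /(_ isT).
have : Num.min 1 (- X / (2 * Y)) * Y <= - X / 2.
  apply: (@le_trans _ _ (- X / (2 * Y) * Y)).
    by rewrite ler_pM2r // ge_min lexx orbT.
  rewrite le_eqVlt; apply/orP; left; apply/eqP; field.
  by rewrite gt_eqF.
lra.
Qed.

(** Convexity with a plain real coefficient, in place of the interval-bundled coefficient of
    [convex_set], so that linear arithmetic applies to it. *)
Definition seg_closed n (S : set 'rV[R]_n) : Prop :=
  forall x y (a : R), S x -> S y -> 0 <= a <= 1 -> S (a *: x + (1 - a) *: y).

Lemma convex_set_seg n (S : set 'rV[R]_n) : convex_set S -> seg_closed S.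
Proof.
move=> cS x y a Sx Sy a01.
have a01' : (0 : R) <= a <= 1 by [].
have := cS x y (Itv01 (andP a01).1 (andP a01).2).
rewrite !in_setE; exact.
Qed.

Lemma dual_cone_seg n (C : set 'rV[R]_n) : seg_closed (dual_cone C).
Proof.
move=> x y a Sx Sy /andP[a0 a1] c Cc; rewrite !dotE addr_ge0 // mulr_ge0 //.
- exact: Sx.
- by rewrite subr_ge0.
- exact: Sy.
Qed.

(** Compare [y] with the point [a *: z + (1 - a) *: y] of [K], divide by [a] and let [a] tend to
    0. *)
Lemma proj_variational n (K : set 'rV[R]_n) x y z : seg_closed K ->
  is_proj K x y -> K z -> dot (x - y) (z - y) <= 0.
Proof.
move=> cK [Ky ymin] Kz; rewrite -oppr_ge0.
apply: (@ge0_of_perturbation _ (dot (z - y) (z - y) / 2)) => a /andP[a0 a1].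
have /ymin : K (a *: z + (1 - a) *: y) by apply: cK => //; rewrite ltW.
rewrite -ler_sqr ?nnegrE ?enorm_ge0 // !enorm_sqr.
have -> : x - (a *: z + (1 - a) *: y) = (x - y) - a *: (z - y).
  by apply/rowP => i; rewrite !mxE; ring.
move: (x - y) (z - y) => d e; rewrite !dotE (dotC e d) => h.
have : 0 <= a * (2 * (- dot d e + a * (dot e e / 2))) by lra.
by rewrite pmulr_rge0 // pmulr_rge0.
Qed.

(** Testing each variational inequality at the other projection and adding bounds |y - y'|^2 by the
    inner product of x - x' and y - y'; Cauchy-Schwarz concludes. *)
Lemma proj_nonexpansive n (K : set 'rV[R]_n) x y x' y' : seg_closed K ->
  is_proj K x y -> is_proj K x' y' -> enorm (y - y') <= enorm (x - x').
Proof.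
move=> cK px py.
have h1 := proj_variational cK px py.1.
have h2 := proj_variational cK py px.1.
have h : dot (y - y') (y - y') <= dot (x - x') (y - y').
  by move: h1 h2; rewrite !dotE !(dotC y' y) !(dotC x' y) !(dotC x y); lra.
have [y0|y0] := eqVneq (enorm (y - y')) 0; first by rewrite y0 enorm_ge0.
rewrite -(@ler_pM2r _ (enorm (y - y'))); last by rewrite lt_def y0 enorm_ge0.
by rewrite -expr2 enorm_sqr; apply: le_trans h (dot_le_enorm _ _).
Qed.

(** * Convex functions: proximal steps and Jensen's inequality *)

Definition convex_on n (S : set 'rV[R]_n) (f : 'rV[R]_n -> R) : Prop :=
  forall x y (a : R), S x -> S y -> 0 <= a <= 1 ->
  f (a *: x + (1 - a) *: y) <= a * f x + (1 - a) * f y.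

Lemma convex_onD n (S : set 'rV[R]_n) f g :
  convex_on S f -> convex_on S g -> convex_on S (fun x => f x + g x).
Proof.
by move=> cf cg x y a Sx Sy a01; have := cf x y a Sx Sy a01;
  have := cg x y a Sx Sy a01; lra.
Qed.

Lemma convex_on_dot n (S : set 'rV[R]_n) g : convex_on S (dot g).
Proof. by move=> x y a _ _ _; rewrite !dotE. Qed.

(** Optimality condition of a proximal step for nonsmooth [h]. On the segment from [y] to [z] the
    quadratic term falls below its chord by exactly [c * a * (1 - a)] times |z - y|^2; dividing by
    [a] and letting it vanish leaves the last term. *)
Lemma prox_inequality n (S : set 'rV[R]_n) (h : 'rV[R]_n -> R) c w y z :
  seg_closed S -> convex_on S h -> S y ->
  (forall x, S x -> h y + c * enorm (y - w) ^+ 2 <= h x + c * enorm (x - w) ^+ 2) ->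
  S z ->
  0 <= h z - h y + c * (dot (z - w) (z - w) - dot (y - w) (y - w) - dot (z - y) (z - y)).
Proof.
move=> cS ch Sy ymin Sz.
apply: (@ge0_of_perturbation _ (c * dot (z - y) (z - y))) => a /andP[a0 a1].
have a01 : 0 <= a <= 1 by rewrite ltW.
have := ymin _ (cS z y a Sz Sy a01); have := ch z y a Sz Sy a01.
rewrite !enorm_sqr.
have -> : a *: z + (1 - a) *: y - w = a *: (z - w) + (1 - a) *: (y - w).
  by apply/rowP => i; rewrite !mxE; ring.
have -> : z - y = (z - w) - (y - w) by rewrite opprB addrA subrK.
move: (z - w) (y - w) => d e; rewrite !dotE (dotC e d) => h1 h2.
rewrite -(pmulr_rge0 _ a0).
move: h1 h2; nra.
Qed.

Lemma jensen_average n (S : set 'rV[R]_n) (f : 'rV[R]_n -> R) (x : nat -> 'rV[R]_n) t :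
  seg_closed S -> convex_on S f -> (forall k, (0 < k)%N -> S (x k)) -> (0 < t)%N ->
  S (average x t) /\ t%:R * f (average x t) <= \sum_(1 <= k < t.+1) f (x k).
Proof.
move=> cS cf Sx; elim: t => // t IH _.
case: t IH => [_|t /(_ isT)[St ft]].
  by rewrite /average !big_nat1 invr1 scale1r mul1r; split => //; exact: Sx.
have h1 : 1 + t%:R != 0 :> R by rewrite nat1r pnatr_eq0.
have h2 : 2 + t%:R != 0 :> R by rewrite -(natrD _ 2) pnatr_eq0.
(* The new average is the convex combination of the old average and the new point with this
   weight. *)
set a : R := t.+1%:R / t.+2%:R.
have a01 : 0 <= a <= 1.
  by rewrite /a divr_ge0 ?ler0n //= ler_pdivrMr ?ltr0n // mul1r ler_nat.
have avgE : average x t.+2 = a *: average x t.+1 + (1 - a) *: x t.+2.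
  rewrite /average big_nat_recr //= scalerDr scalerA.
  by congr (_ *: _ + _ *: _); rewrite /a; field; rewrite ?h1 ?h2.
have Sx2 := Sx t.+2 isT.
split; first by rewrite avgE; apply: cS.
rewrite big_nat_recr //=; apply: le_trans (lerD ft (lexx _)).
rewrite avgE; have := cf _ _ a St Sx2 a01.
rewrite -(@ler_pM2l _ t.+2%:R) ?ltr0n // => /le_trans; apply.
rewrite le_eqVlt; apply/orP; left; apply/eqP.
by rewrite /a; field; rewrite ?h1 ?h2.
Qed.

End EuclideanLemmas.

(** * Compactness *)

Section Topology.
Context {R : realType}.

Lemma dot_continuous n (T : topologicalType) (f g : T -> 'rV[R]_n) :
  continuous f -> continuous g -> continuous (fun x => dot (f x) (g x)).
Proof.
move=> cf cg.
apply: (@continuous_big _ _ +%R 0 xpredT _ _ _ (fun i x => f x 0 i * g x 0 i)).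
  exact: add_continuous.
move=> i _ x; apply: cvgM.
  apply: (@continuous_comp _ _ _ f (fun v : 'rV[R]_n => v 0 i)); first exact: cf.
  exact: coord_continuous.
apply: (@continuous_comp _ _ _ g (fun v : 'rV[R]_n => v 0 i)); first exact: cg.
exact: coord_continuous.
Qed.

Lemma enorm_continuous n : continuous (@enorm R n).
Proof.
move=> x; apply: (@continuous_comp _ _ _ (fun y : 'rV[R]_n => dot y y)).
  by apply: dot_continuous => y; exact: cvg_id.
exact: sqrt_continuous.
Qed.

Lemma mx_norm_le_enorm n (x : 'rV[R]_n) : `|x| <= enorm x.
Proof.
rewrite [leLHS]/Num.norm /= mx_normrE; apply/bigmax_leP; split; first exact: enorm_ge0.
move=> [i j] _ /=; rewrite (ord1 i) -ler_sqr ?nnegrE ?enorm_ge0 //.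
rewrite enorm_sqr real_normK ?num_real // /dot (bigD1 j) //= -expr2 lerDl.
by apply: sumr_ge0 => k _; rewrite -expr2 sqr_ge0.
Qed.

Lemma eball_compact n r : compact (@eball R n r).
Proof.
apply: bounded_closed_compact.
  exists r; split; first exact: num_real.
  by move=> M rM x xr; apply: le_trans (mx_norm_le_enorm x) (le_trans xr (ltW rM)).
apply: (@closed_comp _ _ (@enorm R n) [set x | x <= r]); last exact: closed_le.
by move=> x _; exact: enorm_continuous.
Qed.

Lemma sphere_compact n : compact [set x : 'rV[R]_n | enorm x = 1].
Proof.
apply: (@subclosed_compact _ _ (@eball R n 1)); last 2 first.
- exact: eball_compact.
- by move=> x; rewrite /eball /= => ->.
apply: (@closed_comp _ _ (@enorm R n) [set x | x = 1]); last exact: closed_eq.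
by move=> x _; exact: enorm_continuous.
Qed.

(** Applied later to [y] the opposite of a separating vector, to reach a point where that vector is
    negative. The [+ 1] in the step length covers [y = 0]. *)
Lemma interior_scale n (A : set 'rV[R]_n) x y : interior A x ->
  exists2 a : R, 0 < a & A (x + a *: y).
Proof.
move=> /nbhs_ballP[e /= e0 xA].
exists (e / (2 * (enorm y + 1))).
  by rewrite divr_gt0 // mulr_gt0 // ltr_wpDl // enorm_ge0.
apply: xA; rewrite -ball_normE /ball_ /= opprD addrA subrr add0r normrN.
apply: le_lt_trans (mx_norm_le_enorm _) _.
have y1 : 0 < enorm y + 1 by rewrite ltr_wpDl // enorm_ge0.
rewrite enormZ ger0_norm; last by rewrite divr_ge0 ?mulr_ge0 // ltW.
rewrite -mulrA gtr_pMr // ltr_pdivrMl ?mulr_gt0 // mulr1.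
by have := enorm_ge0 y; lra.
Qed.

Lemma compact_open_dist n (K O : set 'rV[R]_n) : compact K -> open O -> K `<=` O ->
  exists2 e : R, 0 < e & forall x y, K x -> enorm (y - x) < e -> O y.
Proof.
move=> /compact_near_coveringP cK oO KO.
have /(cK R (0^'+)) : forall x, K x ->
    \forall x' \near x & e \near (0 : R)^'+, forall y, enorm (y - x') < e -> O y.
  move=> x /KO Ox; have /nbhs_ballP[d /= d0 xO] := open_nbhs_nbhs (conj oO Ox).
  (* Half of the radius [d] pays for moving the centre to [x'], the other half for the distance from
     [x'] to [y]. *)
  exists (ball x (d / 2), [set e | e < d / 2]).
    by split; [apply: nbhsx_ballx; rewrite divr_gt0|apply: nbhs_right_lt; rewrite divr_gt0].
  move=> [x' e] [/= xx' ed] y ye; apply: xO; rewrite [d]splitr.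
  apply: ball_triangle xx' _; rewrite -ball_normE /ball_ /= distrC.
  by apply: le_lt_trans (mx_norm_le_enorm _) (lt_trans ye ed).
move=> H; near (0 : R)^'+ => e; exists e => [//|x y Kx].
by move: y x Kx; near: e; apply: filterS H => e H y x /H; exact.
Unshelve. all: by end_near. Qed.

(** Here [y] may lie outside [O], as the first iterate may. Pairs closer than some [e] lie in [O],
    where [f] is [k]-Lipschitz; for the others, boundedness of [f] on the ball gives the slope
    [2 * M / e]. *)
Lemma locally_lipschitz_on_compact n m (O U : set 'rV[R]_n) (f : 'rV[R]_n -> 'rV[R]_m)
    (k r : R) :
  closed U -> open O -> U `<=` O -> continuous f -> 0 <= k -> elipschitz O k f ->
  exists2 c : R, 0 <= c & forall x y, U x -> eball r x -> eball r y ->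
    enorm (f y - f x) <= c * enorm (y - x).
Proof.
move=> cU oO UO cf k0 lf.
have [e e0 He] : exists2 e : R, 0 < e & forall x y, (U `&` eball r) x -> enorm (y - x) < e -> O y.
  apply: compact_open_dist oO _.
  - by rewrite setIC; apply: compact_closedI => //; exact: eball_compact.
  - by move=> x [/UO].
have [M HM] : exists M, forall x, eball r x -> enorm (f x) <= M.
  have : compact [set (@enorm R m \o f) x | x in @eball R n r].
    apply: continuous_compact; last exact: eball_compact.
    apply: continuous_subspaceT => x; apply: continuous_comp; first exact: cf.
    exact: enorm_continuous.
  move=> /compact_bounded[M [_ HM]]; exists (M + 1) => x xr.
  have /HM /(_ (enorm (f x))) : M < M + 1 by rewrite ltrDl.
  rewrite /= ger0_norm ?enorm_ge0 //; apply; first by exists x.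
have q0 : 0 <= 2 * `|M| / e by apply: divr_ge0; [exact: mulr_ge0|exact: ltW].
exists (k + 2 * `|M| / e); first exact: addr_ge0.
move=> x y Ux xr yr; have xy0 := enorm_ge0 (y - x).
have [xye|xye] := ltP (enorm (y - x)) e.
  apply: le_trans (lf _ _ _ (UO _ Ux)) _; first exact: (He x).
  by rewrite ler_wpM2r // lerDl.
apply: (@le_trans _ _ (2 * `|M| / e * e)).
  rewrite divfK ?gt_eqF //; apply: le_trans (ler_enormB _ _) _.
  by have := HM _ xr; have := HM _ yr; have := ler_norm M; lra.
apply: (@le_trans _ _ (2 * `|M| / e * enorm (y - x))); first by rewrite ler_wpM2l.
by rewrite ler_wpM2r // lerDr.
Qed.

End Topology.

(** * Weak separation *)

Section Separation.
Context {R : realType}.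

(** The convex cone generated by [A] with strictly positive coefficients: membership of 0 is a
    genuine positive dependency, not the empty combination. *)
Inductive pos_hull n (A : set 'rV[R]_n) : set 'rV[R]_n :=
| pos_hull_mem x : A x -> pos_hull A x
| pos_hullD x y : pos_hull A x -> pos_hull A y -> pos_hull A (x + y)
| pos_hullZ a x : 0 < a -> pos_hull A x -> pos_hull A (a *: x).

Lemma pos_hullS n (A B : set 'rV[R]_n) : A `<=` B -> pos_hull A `<=` pos_hull B.
Proof.
move=> AB x; elim=> {x} [x Ax|x y _ hx _ hy|a x a0 _ hx].
- exact/pos_hull_mem/AB.
- exact: pos_hullD.
- exact: pos_hullZ.
Qed.

Lemma pos_hull_linear_image n (A : set 'rV[R]_n) (f : {linear 'rV[R]_n -> 'rV[R]_n}) z :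
  pos_hull (f @` A) z -> exists2 y, pos_hull A y & f y = z.
Proof.
elim=> {z} [_ [x Ax <-]|_ _ _ [x hx <-] _ [y hy <-]|a _ a0 _ [x hx <-]].
- by exists x => //; exact: pos_hull_mem.
- by exists (x + y); rewrite ?linearD //; exact: pos_hullD.
- by exists (a *: x); rewrite ?linearZ //; exact: pos_hullZ.
Qed.

Lemma pos_hull_dot_gt0 n (A : set 'rV[R]_n) b y :
  (forall x, A x -> 0 < dot b x) -> pos_hull A y -> 0 < dot b y.
Proof.
move=> Ab; elim=> {y} [x /Ab //|x y _ hx _ hy|a x a0 _ hx].
- by rewrite dotDr addr_gt0.
- by rewrite dotZr mulr_gt0.
Qed.

Lemma perturb_finite (T : eqType) (s : seq T) (f g : T -> R) :
  (forall x, x \in s -> 0 < f x) ->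
  exists2 e, 0 < e & forall x, x \in s -> 0 < f x + e * g x.
Proof.
move=> sf.
(* Asking for all smaller [a] as well lets the induction take the minimum of two thresholds. *)
suff [e e0 H] : exists2 e, 0 < e &
    forall a, 0 < a <= e -> forall x, x \in s -> 0 < f x + a * g x.
  by exists e => // x xs; apply: H => //; rewrite e0 lexx.
elim: s sf => [|y s IH] sf; first by exists 1.
have [|e e0 He] := IH; first by move=> x xs; apply: sf; rewrite inE xs orbT.
have fy : 0 < f y by apply: sf; rewrite inE eqxx.
have g0 : 0 < `|g y| + 1 by rewrite ltr_wpDl.
exists (Num.min e (f y / (`|g y| + 1))); first by rewrite lt_min e0 divr_gt0.
move=> a /andP[a0]; rewrite le_min => /andP[ae af] x.
rewrite inE => /predU1P[->|xs]; last by apply: He => //; rewrite a0 ae.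
move: af; rewrite ler_pdivlMr // mulrDr mulr1 => af.
have := ler_norm (- g y); rewrite normrN => h.
have : a * - g y <= a * `|g y| by rewrite ler_pM2l.
rewrite mulrN; lra.
Qed.

(* Gordan's alternative, by projecting onto the orthogonal of one vector. *)
Lemma gordan n (s : seq 'rV[R]_n) :
  (exists b, forall x, x \in s -> 0 < dot b x) \/ pos_hull [set` s] 0.
Proof.
(* Induction on a bound for the length, because the hypothesis is applied both to the projected tail
   and to the tail itself. *)
move: {2}(size s) (leqnn (size s)) => k; elim: k s => [|k IH] [|x s] //= sk;
  try by left; exists 0.
have [->|x0] := eqVneq x 0.
  by right; apply: pos_hull_mem; rewrite /= inE eqxx.
have xx := dot_gt0 x0.
(* Orthogonal projection along [x]; [dotP] below says that it is self-adjoint. *)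
pose P y : 'rV[R]_n := y - (dot y x / dot x x) *: x.
have Padd : linear P.
  by move=> a y z; rewrite /P !dotE mulrDl -mulrA !(scalerDl, scalerDr, opprD, scalerN, scalerA) addrACA.
pose Pm := GRing.isLinear.Build R 'rV[R]_n 'rV[R]_n *:%R P Padd.
pose Pl : {linear 'rV[R]_n -> 'rV[R]_n} := HB.pack P Pm.
have dotP y z : dot (P y) z = dot y (P z).
  by rewrite /P !dotE (dotC z x); ring.
have Px : P x = 0 by rewrite /P divff ?gt_eqF // scale1r subrr.
have sS : [set` s] `<=` [set` x :: s] by move=> y /= ys; rewrite inE ys orbT.
case: (IH [seq P y | y <- s]); first by rewrite size_map.
  move=> [b hb]; left.
  have [|e e0 He] := @perturb_finite _ s (fun y => dot b (P y)) (fun y => dot x y).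
    by move=> y ys; apply: hb; apply: map_f.
  (* [P b] is positive on the tail and zero on [x]; a small multiple of [x] repairs the latter
     without spoiling the former. *)
  exists (P b + e *: x) => y; rewrite inE => /predU1P[->|/He].
    by rewrite dotDl dotP Px dot0r add0r dotZl mulr_gt0.
  by rewrite dotDl dotP dotZl.
rewrite (_ : [set` _] = Pl @` [set` s]); last first.
  apply/seteqP; split=> [_ /mapP[y ys ->]|_ [y ys <-]]; first by exists y.
  exact: map_f.
move=> /pos_hull_linear_image[y hy /= /eqP]; rewrite subr_eq0 => /eqP yE.
(* Now [y], in the hull of the tail, is a multiple of [x]. A nonpositive coefficient yields a
   positive dependency; a positive one makes any [b] positive on the tail positive on [x] too. *)
have [c0|c0] := ltP 0 (dot y x / dot x x); last first.
  right; move: c0; rewrite le_eqVlt => /predU1P[c0|c0].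
    by move: hy; rewrite yE c0 scale0r; apply: pos_hullS.
  rewrite (_ : 0 = y + (- (dot y x / dot x x)) *: x); last first.
    by rewrite scaleNr -yE subrr.
  apply: pos_hullD; first exact: (pos_hullS sS).
  apply: pos_hullZ; first by rewrite oppr_gt0.
  by apply: pos_hull_mem; rewrite /= inE eqxx.
case: (IH s) => //; last by right; apply: (pos_hullS sS).
move=> [b hb]; left; exists b => z; rewrite inE => /predU1P[->|/hb //].
have := pos_hull_dot_gt0 hb hy; rewrite yE dotZr.
by rewrite (pmulr_rgt0 _ c0).
Qed.

(** Each [x] in [A] cuts out of the compact unit sphere the closed set of [b] with [0 <= dot b x].
    Gordan's alternative gives the finite intersection property, since a positive dependency among
    points of the convex set [A] would put 0 in [A]. *)
Lemma weak_separation n (A : set 'rV[R]_n) : seg_closed A -> A !=set0 -> ~ A 0 ->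
  exists2 b, b != 0 & forall x, A x -> 0 <= dot b x.
Proof.
move=> cA [x0 Ax0] A0.
have hullA x : pos_hull A x -> exists t, exists2 a, 0 < t /\ A a & x = t *: a.
  elim=> {x} [x Ax|_ _ _ [t [x [t0 Ax] ->]] _ [r [y [r0 Ay] ->]]|a _ a0 _ [t [x [t0 Ax] ->]]].
  - by exists 1, x; rewrite ?scale1r.
  - have tr : 0 < t + r by rewrite addr_gt0.
    exists (t + r), ((t / (t + r)) *: x + (1 - t / (t + r)) *: y).
      split=> //; apply: cA => //.
      by rewrite divr_ge0 ?(ltW t0) ?(ltW tr) //= ler_pdivrMr // mul1r lerDl ltW.
    rewrite scalerDr !scalerA mulrBr mulr1 mulrCA divff ?gt_eqF // mulr1.
    by rewrite [t + r]addrC addrK.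
  - by exists (a * t), x; rewrite ?scalerA // mulr_gt0.
have := @sphere_compact R n; rewrite compact_In0 /=.
move=> /(_ 'rV[R]_n A (fun x => [set b | enorm b = 1] `&` [set b | 0 <= dot b x])).
case.
- exists (fun x => [set b | 0 <= dot b x]) => // x _.
  apply: (@closed_comp _ _ (fun b => dot b x) [set r | 0 <= r]); last exact: closed_ge.
  by move=> b _; apply: dot_continuous => y; [exact: cvg_id|exact: cst_continuous].
- move=> D DA.
  have DA' x : x \in x0 :: finmap.enum_fset D -> A x.
    by rewrite inE => /predU1P[-> //|xD]; have := DA _ xD; rewrite in_setE.
  (* Adding [x0] to the finite subfamily forces [b] to be nonzero even when [D] is empty. *)
  case: (gordan (x0 :: finmap.enum_fset D)) => [[b hb]|]; last first.
    move=> /(pos_hullS DA') /hullA[t [a [t0 Aa] /esym/eqP]].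
    by rewrite scaler_eq0 (gt_eqF t0) /= => /eqP a0; rewrite a0 in Aa.
  have b0 : b != 0.
    by apply/eqP => b0; have := hb x0; rewrite inE eqxx b0 dot0l ltxx => /(_ isT).
  have nb0 : 0 < enorm b by rewrite sqrtr_gt0 dot_gt0.
  exists ((enorm b)^-1 *: b) => x /= xD; split.
    by rewrite /= enormZ ger0_norm ?invr_ge0 ?ltW // mulVf // gt_eqF.
  rewrite /= dotZl mulr_ge0 // ?invr_ge0 ltW //.
  by apply: hb; rewrite inE xD orbT.
move=> b hb; exists b.
  apply/eqP => b0; have [/= + _] := hb _ Ax0; rewrite b0 enorm0 => /eqP.
  by rewrite eq_sym oner_eq0.
by move=> x /hb[].
Qed.

End Separation.

(** * Lagrange multipliers *)

Section Multiplier.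
Context {R : realType}.

Lemma cone_addr n (C : set 'rV[R]_n) x y :
  seg_closed C -> is_cone C -> C x -> C y -> C (x + y).
Proof.
move=> cC kC Cx Cy.
have -> : x + y = 2 *: (2^-1 *: x + (1 - 2^-1) *: y).
  by rewrite scalerDr !scalerA mulrBr divff // mulr1 !scale1r -[2]/(1 + 1) addrK scale1r.
apply: kC => //; apply: cC => //; lra.
Qed.

Lemma ge0_of_ray (X Y : R) : (forall t, 0 < t -> 0 <= X + t * Y) -> 0 <= X /\ 0 <= Y.
Proof.
move=> h; split.
  by apply: (@ge0_of_perturbation _ _ Y) => a /andP[a0 _]; exact: h.
apply: (@ge0_of_perturbation _ _ X) => a /andP[a0 _].
have := h _ (_ : 0 < a^-1); rewrite invr_gt0 => /(_ a0) h1.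
have := mulr_ge0 (ltW a0) h1; rewrite mulrDr mulrA divff ?gt_eqF // mul1r.
by rewrite addrC.
Qed.

(** Separation yields a pair (a, p), with a on the objective and p on the constraint; the constraint
    qualification excludes a = 0, and p / a is the multiplier. *)
Lemma lagrange_multiplier n m (U : set 'rV[R]_n) (C : set 'rV[R]_m)
    (f : 'rV[R]_n -> R) (Th : 'rV[R]_n -> 'rV[R]_m) us :
  seg_closed U -> convex_on U f -> seg_closed C -> is_cone C ->
  cone_convex U C Th -> constraint_qualification U C Th ->
  interior C !=set0 \/ C = [set 0] ->
  U us -> C (- Th us) -> f us = 0 ->
  (forall u, U u -> C (- Th u) -> 0 <= f u) ->
  exists p, [/\ dual_cone C p, forall u, U u -> 0 <= f u + dot p (Th u) &
                dot p (Th us) = 0].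
Proof.
move=> cU cf cC kC cTh [cq1 cq2] cq Uus Cus fus fmin.
(* [is_cone] scales by positive numbers only, so 0 in [C] is read off from the convexity of [Th] at
   a trivial combination. *)
have C0 : C 0.
  have := cTh us us 1 Uus Uus; rewrite ler01 lexx => /(_ isT).
  by rewrite subrr !scale0r addr0 !scale1r subrr subr0 oppr0.
pose A (z : 'rV[R]_(1 + m)) := exists u c s,
  [/\ U u, C c, f u < s & z = row_mx (s%:M : 'rV[R]_1) (Th u + c)].
have [| |[u [c [s [Uu Cc fs]]]]|b b0 bA] := @weak_separation _ _ A.
- move=> _ _ a [u [c [s [Uu Cc fu ->]]]] [u' [c' [s' [Uu' Cc' fu' ->]]]] a01.
  have a1 : 0 <= 1 - a by case/andP: a01 => _; rewrite subr_ge0.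
  exists (a *: u + (1 - a) *: u'),
    (* The convexity defect of [Th] is absorbed into the cone component. *)
    (a *: c + (1 - a) *: c' - (Th (a *: u + (1 - a) *: u') - a *: Th u - (1 - a) *: Th u')),
    (a * s + (1 - a) * s'); split.
  + exact: cU.
  + by apply: cone_addr => //; [exact: cC|exact: cTh].
  + apply: le_lt_trans (cf _ _ _ Uu Uu' a01) _.
    have [/eqP a0|a0] := boolP (a == 0); first by rewrite a0; lra.
    have {}a0 : 0 < a by rewrite lt_def a0; case/andP: a01.
    by apply: ltr_leD; [rewrite ltr_pM2l|rewrite ler_wpM2l // ltW].
  + rewrite !scale_row_mx add_row_mx; congr row_mx.
      by rewrite !scale_scalar_mx -raddfD.
    by rewrite !scalerDr; apply/rowP => i; rewrite !mxE; ring.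
- by exists (row_mx ((f us + 1)%:M) (Th us + 0)), us, 0, (f us + 1); rewrite ltrDl.
- rewrite -row_mx0 => /eq_row_mx[s0 /esym/eqP].
  rewrite addrC addr_eq0 => /eqP cE.
  have := fmin _ Uu; rewrite -cE => /(_ Cc); rewrite leNgt => /negP; apply.
  by have := congr1 (fun M : 'M[R]_1 => M 0 0) s0; rewrite !mxE eqxx mulr1n => ->.
set a := lsubmx b 0 0; set p := rsubmx b.
have main u c e : U u -> C c -> 0 < e -> 0 <= a * (f u + e) + dot p (Th u + c).
  move=> Uu Cc e0.
  have /bA : A (row_mx ((f u + e)%:M) (Th u + c)).
    by exists u, c, (f u + e); rewrite ltrDl.
  rewrite -[b]hsubmxK dot_row_mx.
  by rewrite [dot (lsubmx b) _]big_ord1 [_%:M _ _]mxE eqxx mulr1n.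
(* The signs of [a] and of [p] on [C] come from the unbounded directions of [A]: raising [s], then
   scaling [c]. *)
have a_ge0 : 0 <= a.
  have [] // := @ge0_of_ray (a * f us + dot p (Th us)) a.
  by move=> t t0; have := main _ _ _ Uus C0 t0; rewrite addr0; lra.
have pC : dual_cone C p.
  move=> c Cc; have [] // := @ge0_of_ray (a * (f us + 1) + dot p (Th us)) (dot p c).
  by move=> t t0; have := main _ _ _ Uus (kC _ _ t0 Cc) ltr01; rewrite !dotE; lra.
have L_ge0 u : U u -> 0 <= a * f u + dot p (Th u).
  move=> Uu; apply: (@ge0_of_perturbation _ _ a) => t /andP[t0 _].
  by have := main _ _ _ Uu C0 t0; rewrite addr0; lra.
(* If [a = 0], then [p] is nonzero and [dot p (Th u)] is nonnegative on [U]. Pushing along [- p],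
   from an interior point of [C] or from 0 inside the image of [Th], produces a [u] where it is
   negative. *)
have a_gt0 : 0 < a.
  rewrite lt_def a_ge0 andbT; apply/eqP => a0.
  have p0 : p != 0.
    apply: contra_neq b0 => p0; rewrite -[b]hsubmxK -/p p0.
    rewrite (_ : lsubmx b = 0) ?row_mx0 //.
    by apply/rowP => i; rewrite (ord1 i) -/a a0 mxE.
  have pp := dot_gt0 p0.
  have {}L_ge0 u : U u -> 0 <= dot p (Th u).
    by move=> /L_ge0; rewrite a0 mul0r add0r.
  case: cq => [/cq1[u [Uu iu]]|/cq2 i0].
    have [t t0 /pC] := interior_scale (- p) iu.
    have := L_ge0 _ Uu; rewrite !dotE; have := mulr_gt0 t0 pp; lra.
  have [t t0 [u Uu uE]] := interior_scale (- p) i0.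
  have := L_ge0 _ Uu; rewrite uE !dotE; have := mulr_gt0 t0 pp; lra.
exists (a^-1 *: p); split.
- by move=> c /pC pc; rewrite dotZl mulr_ge0 // invr_ge0.
- move=> u /L_ge0; rewrite dotZl -(pmulr_rge0 _ (_ : 0 < a^-1)) ?invr_gt0 //.
  by rewrite mulrDr mulKf // gt_eqF.
- rewrite dotZl; suff -> : dot p (Th us) = 0 by rewrite mulr0.
  apply/eqP; rewrite eq_le; apply/andP; split.
    by have := pC _ Cus; rewrite dotNr oppr_ge0.
  by have := L_ge0 _ Uus; rewrite fus mulr0 add0r.
Qed.

End Multiplier.

(** * One iteration *)

Section OneStep.
Context {R : realType}.

Definition energy n m (L tau eta alpha gamma : R) (z : 'rV[R]_n) (l : 'rV[R]_m)
    (v : 'rV[R]_n) (p : 'rV[R]_m) (d : 'rV[R]_n) : R :=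
  1 / (2 * alpha) / (1 - eta) * dot (v - z) (v - z)
  + 1 / (2 * gamma) * dot (p - l) (p - l) + (L + gamma * tau ^+ 2) / 2 * dot d d.

Lemma energy_ge0 n m (L tau eta alpha gamma : R) (z : 'rV[R]_n) (l : 'rV[R]_m) v p d :
  0 <= L -> 0 < tau -> eta < 1 -> 0 < alpha -> 0 < gamma ->
  0 <= energy L tau eta alpha gamma z l v p d.
Proof.
move=> L0 t0 e1 a0 g0; have e1' : 0 < 1 - eta by rewrite subr_gt0.
have i1 : 0 < 1 / (2 * alpha) / (1 - eta) by rewrite !divr_gt0 ?mulr_gt0.
have i2 : 0 < 1 / (2 * gamma) by rewrite divr_gt0 ?mulr_gt0.
have i3 : 0 < gamma * tau ^+ 2 by rewrite mulr_gt0 ?exprn_gt0.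
have i4 : 0 <= (L + gamma * tau ^+ 2) / 2 by lra.
by rewrite /energy !addr_ge0 // mulr_ge0 ?dot_ge0 // ltW.
Qed.

(** Quadratic terms of two consecutive proximal steps, the first tested at [u2], the second at [z].
    After elimination of [v0] and [v2] this is a polynomial identity; the terms in [z] telescope. *)
Lemma proximal_identity n (c eta : R) (z u1 u2 v0 v1 v2 : 'rV[R]_n) :
  eta != 0 -> eta != 1 ->
  v1 = (1 - eta) *: u1 + eta *: v0 -> v2 = (1 - eta) *: u2 + eta *: v1 ->
  c * (dot (z - v1) (z - v1) - dot (u2 - v1) (u2 - v1) - dot (z - u2) (z - u2))
  + c * (dot (u2 - v0) (u2 - v0) - dot (u1 - v0) (u1 - v0) - dot (u2 - u1) (u2 - u1))
  = c / (1 - eta) * dot (v1 - z) (v1 - z) - c / (1 - eta) * dot (v2 - z) (v2 - z)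
    - c / eta * (eta ^+ 2 + eta - 1) * dot (u2 - v1) (u2 - v1)
    - c / eta * (dot (u1 - v1) (u1 - v1) + dot (u2 - u1) (u2 - u1)).
Proof.
move=> e0 e1 v1E ->.
have -> : v0 = eta^-1 *: v1 - (eta^-1 * (1 - eta)) *: u1.
  by rewrite v1E scalerDr !scalerA mulVf // scale1r addrC addKr.
rewrite !dotE ?(dotC v1 z) ?(dotC u2 z) ?(dotC u1 z) ?(dotC u2 u1) ?(dotC v1 u1) ?(dotC v1 u2).
by field; rewrite e0 subr_eq0 eq_sym.
Qed.

(** The sum of the two projection inequalities, after polarizing and dropping half of |p0 -
    p1|^2. *)
Lemma dual_inequality m (gamma : R) (p0 p1 q1 l T1 : 'rV[R]_m) :
  dot (p0 + gamma *: T1 - p1) (l - p1) <= 0 ->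
  dot (p1 + gamma *: T1 - q1) (p1 - q1) <= 0 ->
  gamma * dot (l - q1) T1 <=
    1 / 2 * (dot (p0 - l) (p0 - l) - dot (p1 - l) (p1 - l)) - dot (q1 - p1) (q1 - p1).
Proof.
have := dot_ge0 (p0 - p1).
rewrite !dotE !(dotC _ T1) !(dotC _ l) !(dotC p1 p0) !(dotC q1 p1); lra.
Qed.

(** Young's inequality handles [a * b]. Completing the square in [x] leaves a quarter of
    [gamma * tau ^+ 2 * b ^+ 2], which [tau * b ^+ 2] dominates because [gamma * tau < 1]. *)
Lemma quadratic_bound (L tau gamma a b x : R) :
  0 <= L -> 0 < tau -> 0 < gamma -> gamma * tau < 1 ->
  L * (a * b) + gamma * tau ^+ 2 * (a * b) + tau * (x * b) - x ^+ 2 / gamma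
    - (gamma * tau ^+ 2 + L + tau) * b ^+ 2
  <= (L + gamma * tau ^+ 2) / 2 * (a ^+ 2 - b ^+ 2).
Proof.
move=> L0 t0 g0 gt1.
have gt2 : 0 < gamma * tau ^+ 2 by rewrite mulr_gt0 ?exprn_gt0.
have gt0 : 0 < gamma * tau by rewrite mulr_gt0.
have h1 : 0 <= (L + gamma * tau ^+ 2) / 2 * (a - b) ^+ 2.
  by rewrite mulr_ge0 ?sqr_ge0 //; lra.
have h2 : 0 <= gamma^-1 * (x - gamma * tau * b / 2) ^+ 2.
  by rewrite mulr_ge0 ?sqr_ge0 // invr_ge0 ltW.
have h3 : 0 <= tau * (1 - gamma * tau) * b ^+ 2.
  by rewrite mulr_ge0 ?sqr_ge0 // ltW // mulr_gt0 // subr_gt0.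
have h4 : 0 <= tau * (gamma * tau) * b ^+ 2.
  by rewrite mulr_ge0 ?sqr_ge0 // ltW // mulr_gt0.
have e2 : gamma^-1 * (x - gamma * tau * b / 2) ^+ 2
    = x ^+ 2 / gamma - tau * (x * b) + tau * (gamma * tau) * b ^+ 2 / 4.
  by field; rewrite gt_eqF.
rewrite e2 in h2; lra.
Qed.

(** Subscripts 0, 1, 2 mark consecutive iterations; [g], [T] and [j] are values of [G], [Theta] and
    [J]. The cross terms come from the two proximal steps using different gradients and
    multipliers. *)
Lemma one_step n m (L tau eta alpha gamma : R)
    (z u0 u1 u2 v0 v1 v2 g0 g1 gz : 'rV[R]_n) (l p0 p1 q0 q1 T1 T2 Tz : 'rV[R]_m)
    (jz j1 j2 : R) :
  0 <= L -> 0 < tau -> 0 < gamma -> gamma * tau < 1 -> 0 < eta < 1 ->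
  0 <= eta ^+ 2 + eta - 1 -> 0 < alpha ->
  gamma * tau ^+ 2 + L + tau <= 1 / (2 * alpha) / eta ->
  v1 = (1 - eta) *: u1 + eta *: v0 -> v2 = (1 - eta) *: u2 + eta *: v1 ->
  0 <= dot g1 (z - u2) + jz - j2 + dot q1 (Tz - T2)
    + 1 / (2 * alpha) * (dot (z - v1) (z - v1) - dot (u2 - v1) (u2 - v1) - dot (z - u2) (z - u2)) ->
  0 <= dot g0 (u2 - u1) + j2 - j1 + dot q0 (T2 - T1)
    + 1 / (2 * alpha) * (dot (u2 - v0) (u2 - v0) - dot (u1 - v0) (u1 - v0) - dot (u2 - u1) (u2 - u1)) ->
  0 <= dot (g1 - gz) (u1 - z) ->
  enorm (g1 - g0) <= L * enorm (u1 - u0) ->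
  dot (p0 + gamma *: T1 - p1) (l - p1) <= 0 ->
  dot (p1 + gamma *: T1 - q1) (p1 - q1) <= 0 ->
  enorm (q0 - p1) <= gamma * tau * enorm (u1 - u0) ->
  enorm (T2 - T1) <= tau * enorm (u2 - u1) ->
  dot gz (u1 - z) + j1 - jz + dot l T1 - dot q1 Tz
  <= energy L tau eta alpha gamma z l v1 p0 (u1 - u0)
     - energy L tau eta alpha gamma z l v2 p1 (u2 - u1).
Proof.
move=> L0 t0 ga0 gt1 /andP[e0 e1] phi al0 stepsize v1E v2E prox1 prox0 mono lipG vip viq qp lipT.
have eta1 : eta != 1 by rewrite lt_eqF.
have primal := @proximal_identity n (1 / (2 * alpha)) eta z u1 u2 v0 v1 v2
  (lt0r_neq0 e0) eta1 v1E v2E.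
have c0 : 0 <= 1 / (2 * alpha) / eta by rewrite ltW // !divr_gt0 ?mulr_gt0.
have drop1 : 0 <= 1 / (2 * alpha) / eta * (eta ^+ 2 + eta - 1) * dot (u2 - v1) (u2 - v1).
  by rewrite mulr_ge0 ?dot_ge0 // mulr_ge0.
have drop2 : 0 <= 1 / (2 * alpha) / eta * dot (u1 - v1) (u1 - v1).
  by rewrite mulr_ge0 ?dot_ge0.
have step : (gamma * tau ^+ 2 + L + tau) * dot (u2 - u1) (u2 - u1)
    <= 1 / (2 * alpha) / eta * dot (u2 - u1) (u2 - u1).
  by rewrite ler_wpM2r ?dot_ge0.
set a := enorm (u1 - u0) in lipG qp; set b := enorm (u2 - u1) in lipT.
have a0 : 0 <= a := enorm_ge0 _; have b0 : 0 <= b := enorm_ge0 _.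
set x := enorm (q1 - p1).
have x0 : 0 <= x := enorm_ge0 _.
have gcross : - dot (g1 - g0) (u2 - u1) <= L * (a * b).
  rewrite -dotNr mulrA; apply: le_trans (dot_le_enorm _ _) _.
  by rewrite enormN ler_wpM2r.
(* Passing through [p1]: the part [q0 - p1] is controlled by the primal displacement, and [x] is
   absorbed by the negative square in [dual]. *)
have qcross : dot (q0 - q1) (T2 - T1) <= (gamma * tau * a + x) * (tau * b).
  apply: le_trans (dot_le_enorm _ _) _; apply: ler_pM; rewrite ?enorm_ge0 //.
  have -> : q0 - q1 = (q0 - p1) + (p1 - q1) by rewrite addrA subrK.
  by apply: le_trans (ler_enormD _ _) _; rewrite lerD // enormB.
have dual : dot (l - q1) T1 <= 1 / (2 * gamma) * dot (p0 - l) (p0 - l)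
    - 1 / (2 * gamma) * dot (p1 - l) (p1 - l) - x ^+ 2 / gamma.
  rewrite -(ler_pM2l ga0); apply: le_trans (dual_inequality vip viq) _.
  rewrite /x enorm_sqr le_eqVlt; apply/orP; left; apply/eqP; field.
  by rewrite gt_eqF.
have quad := @quadratic_bound L tau gamma a b x L0 t0 ga0 gt1.
have aa : dot (u1 - u0) (u1 - u0) = a ^+ 2 by rewrite enorm_sqr.
have bb : dot (u2 - u1) (u2 - u1) = b ^+ 2 by rewrite enorm_sqr.
have gsplit : dot g1 (z - u2) + dot g0 (u2 - u1)
    = - dot gz (u1 - z) - dot (g1 - gz) (u1 - z) - dot (g1 - g0) (u2 - u1).
  by rewrite !dotE; ring.
have qsplit : dot q1 (Tz - T2) + dot q0 (T2 - T1)
    = dot q1 Tz - dot q1 T1 + dot (q0 - q1) (T2 - T1).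
  by rewrite !dotE; ring.
have lsplit : dot (l - q1) T1 = dot l T1 - dot q1 T1 by rewrite !dotE.
rewrite /energy aa bb; rewrite bb in primal prox0 step.
lra.
Qed.

End OneStep.

(** * Energy descent, boundedness and averages *)

Lemma eventually_bounded (R : realDomainType) (x : nat -> R) N M :
  (forall k, (N <= k)%N -> x k <= M) -> exists M', forall k, x k <= M'.
Proof.
move=> H; exists (`|M| + \sum_(i < N) `|x i|) => k.
have s0 : 0 <= \sum_(i < N) `|x i| by apply: sumr_ge0.
have [Nk|kN] := leqP N k.
  by apply: le_trans (H _ Nk) (le_trans (ler_norm _) _); rewrite lerDl.
rewrite (bigD1 (Ordinal kN)) //= addrCA; apply: le_trans (ler_norm _) _.
by rewrite lerDl addr_ge0 // sumr_ge0.
Qed.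

Section Iteration.
Context {R : realType} {n m : nat} {G : 'rV[R]_n -> 'rV[R]_n} {U : set 'rV[R]_n}
  {J : 'rV[R]_n -> \bar R} {Theta : 'rV[R]_n -> 'rV[R]_m} {C : set 'rV[R]_m}
  {L tau eta alpha gamma : R}
  {v u : nat -> 'rV[R]_n} {p q : nat -> 'rV[R]_m}.
Context (U_convex : seg_closed U) (J_fin : forall x, U x -> J x \is a fin_num)
  (J_proper : proper_fun J) (J_convex : econvex J)
  (Theta_convex : cone_convex U C Theta) (L_ge0 : 0 <= L)
  (G_lip : elipschitz U L G) (tau_gt0 : 0 < tau) (Theta_lip : elipschitz U tau Theta)
  (eta01 : 0 < eta < 1) (eta_golden : 0 <= eta ^+ 2 + eta - 1)
  (gamma_gt0 : 0 < gamma) (gamma_tau : gamma * tau < 1) (alpha_gt0 : 0 < alpha)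
  (stepsize : gamma * tau ^+ 2 + L + tau <= 1 / (2 * alpha) / eta)
  (G_mono : monotone_on U G)
  (alavi : ALAVI U C G J Theta eta alpha gamma v u p q).

Local Notation j := (fun x => fine (J x)).

(** Jensen's inequality for [J] is run on its effective domain because the input [u 1] need not lie
    in [U]. *)
Lemma dom_seg_closed : seg_closed [set x | J x \is a fin_num].
Proof.
move=> x y a /= Jx Jy a01; rewrite fin_numElt (J_proper.1 _) /=.
apply: le_lt_trans (J_convex x y a01) _.
by rewrite -(fineK Jx) -(fineK Jy) -!EFinM -EFinD ltry.
Qed.

Lemma fine_convex_dom : convex_on [set x | J x \is a fin_num] j.
Proof.
move=> x y a /= Jx Jy a01; have := J_convex x y a01.
rewrite -{1}(fineK Jx) -{1}(fineK Jy) -(fineK (dom_seg_closed Jx Jy a01)).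
by rewrite -!EFinM -EFinD lee_fin.
Qed.

Lemma fine_convex : convex_on U j.
Proof. by move=> x y a Ux Uy; apply: fine_convex_dom => /=; exact: J_fin. Qed.

Lemma dot_Theta_convex l : dual_cone C l -> convex_on U (fun x => dot l (Theta x)).
Proof.
move=> lC x y a Ux Uy a01.
by have := lC _ (Theta_convex Ux Uy a01); rewrite !dotE; lra.
Qed.

Lemma q_dual k : (0 < k)%N -> dual_cone C (q k).
Proof. by move=> /alavi[_ []]. Qed.

Lemma u_dom k : (1 < k)%N -> U (u k).
Proof. by case: k => // k k0; have [_ _ []] := alavi k0. Qed.

Lemma iterate_prox k z : (0 < k)%N -> U z ->
  0 <= dot (G (u k)) (z - u k.+1) + j z - j (u k.+1)
    + dot (q k) (Theta z - Theta (u k.+1))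
    + 1 / (2 * alpha) * (dot (z - v k) (z - v k)
        - dot (u k.+1 - v k) (u k.+1 - v k) - dot (z - u k.+1) (z - u k.+1)).
Proof.
move=> k0 Uz; have [_ _ [Uu umin] _] := alavi k0.
have hconv : convex_on U (fun x => dot (G (u k)) x + j x + dot (q k) (Theta x)).
  by do 2?apply: convex_onD; [exact: convex_on_dot|exact: fine_convex|exact/dot_Theta_convex/q_dual].
have := @prox_inequality _ _ _ _ (1 / (2 * alpha)) (v k) (u k.+1) z U_convex hconv Uu _ Uz.
rewrite !dotE => H; apply: le_trans (H _) _; last by lra.
move=> x Ux; have := umin _ Ux.
by rewrite -(fineK (J_fin Uu)) -(fineK (J_fin Ux)) -!EFinD lee_fin.
Qed.

(** Real counterpart of [Psi] at [(u k, q k)]. As [fine] sends infinities to 0, it is faithful at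
    [k = 1] only once [J (u 1)] is known to be finite. *)
Definition gap_term k (z : 'rV[R]_n) (l : 'rV[R]_m) : R :=
  dot (G z) (u k - z) + j (u k) - j z + dot l (Theta (u k)) - dot (q k) (Theta z).

(* E_(k+1) in the indexing of the header. *)
Definition iterate_energy (z : 'rV[R]_n) (l : 'rV[R]_m) k : R :=
  energy L tau eta alpha gamma z l (v k.+1) (p k) (u k.+1 - u k).

(** With [1 < k] the three iterates involved lie in [U], where the Lipschitz and monotonicity
    hypotheses apply. *)
Lemma gap_term_le k z l : (1 < k)%N -> U z -> dual_cone C l ->
  gap_term k.+1 z l <= iterate_energy z l k - iterate_energy z l k.+1.
Proof.
move=> k1 Uz lC; have k0 : (0 < k)%N := ltnW k1.
have [_ qk _ pk] := alavi k0; have [vk1 qk1 _ pk1] := alavi (ltn0Sn k).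
have [vk2 _ _ _] := alavi (ltn0Sn k.+1).
have Uk := u_dom k1; have Uk1 : U (u k.+1) by exact: u_dom.
have Uk2 : U (u k.+2) by exact: u_dom.
have cC := @dual_cone_seg R m C.
apply: (one_step L_ge0 tau_gt0 gamma_gt0 gamma_tau eta01 eta_golden alpha_gt0 stepsize
  vk1 vk2 (iterate_prox (ltn0Sn k) Uz) (iterate_prox k0 Uk2) (G_mono Uk1 Uz)
  (G_lip Uk1 Uk)).
- exact: (proj_variational cC pk lC).
- by apply: (proj_variational cC qk1); case: pk.
(* [q k] and [p k.+1] project points that share [p k] and differ only by [gamma] times a difference
   of values of [Theta]. *)
- apply: le_trans (proj_nonexpansive cC qk pk) _.
  rewrite opprD addrACA subrr add0r -scalerBr enormZ gtr0_norm // -mulrA ler_pM2l //.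
  by rewrite [enorm (u k.+1 - _)]enormB; exact: Theta_lip.
- exact: Theta_lip.
Qed.

Lemma iterate_energy_ge0 z l k : 0 <= iterate_energy z l k.
Proof. by apply: energy_ge0 => //; case/andP: eta01. Qed.

(** Descent controls the terms from [k = 3] on, which telescope; the first two are bounded
    separately by [B]. *)
Lemma gap_sum_le t z l B : (0 < t)%N -> U z -> dual_cone C l -> 0 <= B ->
  gap_term 1 z l <= B -> gap_term 2 z l <= B ->
  \sum_(1 <= k < t.+1) gap_term k z l <= 2 * B + iterate_energy z l 2.
Proof.
move=> t0 Uz lC B0 B1 B2; have E2 := iterate_energy_ge0 z l 2.
case: t t0 => // -[_|t _]; first by rewrite big_nat1; lra.
suff : \sum_(1 <= k < t.+3) gap_term k z l + iterate_energy z l t.+2 <=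
  gap_term 1 z l + gap_term 2 z l + iterate_energy z l 2.
  by have := iterate_energy_ge0 z l t.+2; lra.
elim: t => [|t IH]; first by rewrite big_nat_recr //= big_nat1.
rewrite big_nat_recr //=; have := @gap_term_le t.+2 z l isT Uz lC; lra.
Qed.

Lemma iterates_bounded us ps : U us -> dual_cone C ps ->
  (forall k, (1 < k)%N -> 0 <= gap_term k us ps) ->
  exists rt, 0 < rt /\ forall k, (0 < k)%N -> wnorm (v k) (u k) (p k) <= rt.
Proof.
move=> Uus psC gap0; have /andP[eta0 eta1] := eta01.
have e1 : 0 < 1 - eta by rewrite subr_gt0.
set c1 := 1 / (2 * alpha) / (1 - eta); set c2 := 1 / (2 * gamma).
have c10 : 0 < c1 by rewrite !divr_gt0 ?mulr_gt0.
have c20 : 0 < c2 by rewrite divr_gt0 ?mulr_gt0.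
pose M := iterate_energy us ps 2.
have EM k : (1 < k)%N -> iterate_energy us ps k <= M.
  elim: k => // -[//|k IH] _; case: k IH => [//|k IH].
  apply: le_trans (IH isT); rewrite -subr_ge0.
  by apply: le_trans (gap0 k.+3 isT) (gap_term_le _ _ _).
have cd0 : 0 <= (L + gamma * tau ^+ 2) / 2.
  by rewrite divr_ge0 // addr_ge0 // mulr_ge0 ?exprn_ge0 // ltW.
(* The elementary x <= 1 + x^2 replaces a square root; the same is done for [p]. *)
have vb k : (1 < k)%N -> enorm (v k.+1) <= enorm us + (1 + M / c1).
  move=> /EM; rewrite /iterate_energy /energy -/c1 -/c2 => h.
  have h2 := mulr_ge0 (ltW c20) (dot_ge0 (p k - ps)).
  have h3 := mulr_ge0 cd0 (dot_ge0 (u k.+1 - u k)).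
  have h4 : enorm (v k.+1 - us) ^+ 2 <= M / c1.
    by rewrite ler_pdivlMr // mulrC enorm_sqr; lra.
  have := ler_enormD us (v k.+1 - us); rewrite addrC subrK.
  by have := sqr_ge0 (enorm (v k.+1 - us) - 1); rewrite sqrrB1; nra.
have pb k : (1 < k)%N -> enorm (p k) <= enorm ps + (1 + M / c2).
  move=> /EM; rewrite /iterate_energy /energy -/c1 -/c2 => h.
  have h2 := mulr_ge0 (ltW c10) (dot_ge0 (v k.+1 - us)).
  have h3 := mulr_ge0 cd0 (dot_ge0 (u k.+1 - u k)).
  have h4 : enorm (p k - ps) ^+ 2 <= M / c2.
    by rewrite ler_pdivlMr // mulrC enorm_sqr; lra.
  have := ler_enormD ps (p k - ps); rewrite addrC subrK.
  by have := sqr_ge0 (enorm (p k - ps) - 1); rewrite sqrrB1; nra.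
have [Mv vM] : exists Mv, forall k, enorm (v k) <= Mv.
  by apply: (@eventually_bounded _ _ 3 (enorm us + (1 + M / c1))) => -[//|k] k2; exact: vb.
have [Mp pM] : exists Mp, forall k, enorm (p k) <= Mp.
  by apply: (@eventually_bounded _ _ 2 (enorm ps + (1 + M / c2))) => k k2; exact: pb.
have [Mu uM] : exists Mu, forall k, enorm (u k) <= Mu.
  (* The energy does not bound [u] directly; [u] is recovered from two consecutive [v] by inverting
     the averaging step. *)
  apply: (@eventually_bounded _ _ 1 ((1 - eta)^-1 * (Mv + eta * Mv))) => -[//|k] _.
  have [vk _ _ _] := alavi (ltn0Sn k).
  rewrite ler_pdivlMl //; apply: (@le_trans _ _ (enorm (v k.+1 - eta *: v k))).
    by rewrite vk /= addrK enormZ gtr0_norm.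
  apply: le_trans (ler_enormB _ _) _.
  by rewrite enormZ gtr0_norm // lerD // ler_pM2l.
exists (`|Mv| + `|Mu| + `|Mp| + 1); split.
  by rewrite ltr_wpDl // !addr_ge0.
move=> k _; rewrite /wnorm.
have hv := le_trans (vM k) (ler_norm _); have hu := le_trans (uM k) (ler_norm _).
have hp := le_trans (pM k) (ler_norm _).
have v0 := enorm_ge0 (v k); have u0 := enorm_ge0 (u k); have p0 := enorm_ge0 (p k).
apply: (@le_trans _ _ (Num.sqrt ((enorm (v k) + enorm (u k) + enorm (p k)) ^+ 2))).
  rewrite ler_sqrt ?sqr_ge0 //.
  have := mulr_ge0 v0 u0; have := mulr_ge0 v0 p0; have := mulr_ge0 u0 p0; lra.
by rewrite sqrtr_sqr ger0_norm ?addr_ge0 //; lra.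
Qed.

(** * Bounds uniform over the index set of the gap function *)

Lemma lipschitz_bounded d1 d2 (f : 'rV[R]_d1 -> 'rV[R]_d2) (S : set 'rV[R]_d1) K r x0 :
  0 <= K -> elipschitz S K f -> S x0 ->
  exists2 M, 0 <= M & forall z, S z -> eball r z -> enorm (f z) <= M.
Proof.
move=> K0 lf Sx0; exists (enorm (f x0) + K * (`|r| + enorm x0)).
  by rewrite addr_ge0 ?enorm_ge0 // mulr_ge0 // addr_ge0 ?enorm_ge0.
move=> z Sz zr; have := ler_enormD (f x0) (f z - f x0); rewrite addrC subrK.
move=> /le_trans; apply; rewrite lerD2l; apply: le_trans (lf _ _ Sz Sx0) _.
rewrite ler_wpM2l //; apply: le_trans (ler_enormB _ _) _.
by rewrite lerD2r; apply: le_trans zr (ler_norm r).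
Qed.

Lemma gap_sum_bounded r : 0 <= r -> exists B, forall t z l,
  (0 < t)%N -> U z -> eball r z -> dual_cone C l -> eball r l ->
  \sum_(1 <= k < t.+1) gap_term k z l <= B.
Proof.
move=> r0; have /andP[eta0 eta1] := eta01.
have e1 : 0 < 1 - eta by rewrite subr_gt0.
have U2 : U (u 2) by exact: u_dom.
have [MG MG0 HG] := lipschitz_bounded r L_ge0 G_lip U2.
have [MT MT0 HT] := lipschitz_bounded r (ltW tau_gt0) Theta_lip U2.
have al0 : 0 <= 1 / (2 * alpha) by rewrite divr_ge0 ?mulr_ge0 // ltW.
pose N k := enorm (q k).
(* The optimality inequality of the first iteration bounds [J] from below on the ball. *)
have [MJ HJ] : exists MJ, forall z, U z -> eball r z -> - j z <= MJ.
  exists (enorm (G (u 1)) * (r + enorm (u 2)) - j (u 2)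
    + N 1%N * (MT + enorm (Theta (u 2))) + 1 / (2 * alpha) * (r + enorm (v 1)) ^+ 2).
  move=> z Uz zr; have := @iterate_prox 1 z isT Uz.
  have h1 : dot (G (u 1)) (z - u 2) <= enorm (G (u 1)) * (r + enorm (u 2)).
    apply: le_trans (dot_le_enorm _ _) _; rewrite ler_wpM2l ?enorm_ge0 //.
    by apply: le_trans (ler_enormB _ _) _; rewrite lerD2r.
  have h2 : dot (q 1) (Theta z - Theta (u 2)) <= N 1%N * (MT + enorm (Theta (u 2))).
    apply: le_trans (dot_le_enorm _ _) _; rewrite ler_wpM2l ?enorm_ge0 //.
    by apply: le_trans (ler_enormB _ _) _; rewrite lerD2r; exact: HT.
  have h3 : 1 / (2 * alpha) * (dot (z - v 1) (z - v 1)
        - dot (u 2 - v 1) (u 2 - v 1) - dot (z - u 2) (z - u 2))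
      <= 1 / (2 * alpha) * (r + enorm (v 1)) ^+ 2.
    rewrite ler_wpM2l //; have := dot_ge0 (u 2 - v 1); have := dot_ge0 (z - u 2).
    suff : dot (z - v 1) (z - v 1) <= (r + enorm (v 1)) ^+ 2 by lra.
    rewrite -enorm_sqr ler_sqr ?nnegrE ?addr_ge0 ?enorm_ge0 //.
    by apply: le_trans (ler_enormB _ _) _; rewrite lerD2r.
  lra.
pose b k := MG * (enorm (u k) + r) + j (u k) + MJ + r * enorm (Theta (u k)) + N k * MT.
have gapb k z l : U z -> eball r z -> eball r l -> gap_term k z l <= b k.
  move=> Uz zr lr; rewrite /gap_term /b.
  have h1 : dot (G z) (u k - z) <= MG * (enorm (u k) + r).
    apply: le_trans (dot_le_enorm _ _) _; apply: ler_pM; rewrite ?enorm_ge0 //.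
      exact: HG.
    by apply: le_trans (ler_enormB _ _) _; rewrite lerD2l.
  have h2 : dot l (Theta (u k)) <= r * enorm (Theta (u k)).
    by apply: le_trans (dot_le_enorm _ _) _; rewrite ler_wpM2r ?enorm_ge0.
  have h3 : - dot (q k) (Theta z) <= N k * MT.
    rewrite -dotNl; apply: le_trans (dot_le_enorm _ _) _.
    by rewrite enormN ler_wpM2l ?enorm_ge0 // HT.
  have := HJ _ Uz zr; lra.
pose e := 1 / (2 * alpha) / (1 - eta) * (enorm (v 3) + r) ^+ 2
  + 1 / (2 * gamma) * (enorm (p 2) + r) ^+ 2
  + (L + gamma * tau ^+ 2) / 2 * dot (u 3 - u 2) (u 3 - u 2).
have Eb z l : eball r z -> eball r l -> iterate_energy z l 2 <= e.
  move=> zr lr; rewrite /iterate_energy /energy /e !lerD //.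
    rewrite ler_wpM2l; [by []|by rewrite divr_ge0 // ltW|].
    rewrite -enorm_sqr ler_sqr ?nnegrE ?addr_ge0 ?enorm_ge0 //.
    by apply: le_trans (ler_enormB _ _) _; rewrite lerD2l.
  rewrite ler_wpM2l; [by []|by rewrite divr_ge0 ?mulr_ge0 // ltW|].
  rewrite -enorm_sqr ler_sqr ?nnegrE ?addr_ge0 ?enorm_ge0 //.
  by apply: le_trans (ler_enormB _ _) _; rewrite lerD2l.
exists (2 * (`|b 1%N| + `|b 2%N|) + e) => t z l t0 Uz zr lC lr.
have n1 := ler_norm (b 1%N); have n2 := ler_norm (b 2%N).
have m1 := normr_ge0 (b 1%N); have m2 := normr_ge0 (b 2%N).
have g1 := gapb 1%N _ _ Uz zr lr; have g2 := gapb 2%N _ _ Uz zr lr.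
have := @gap_sum_le t z l (`|b 1%N| + `|b 2%N|) t0 Uz lC (addr_ge0 m1 m2).
have := Eb _ _ zr lr.
move=> E /(_ _ _)/le_trans -> //; lra.
Qed.

Lemma eball_seg_closed d r : seg_closed (@eball R d r).
Proof.
move=> x y a xr yr /andP[a0 a1]; apply: le_trans (ler_enormD _ _) _.
have a1' : 0 <= 1 - a by rewrite subr_ge0.
rewrite !enormZ !ger0_norm //.
have := ler_wpM2l a0 xr; have := ler_wpM2l a1' yr; lra.
Qed.

(* The first iterate may lie outside [U], where [Theta] is not known to be
   convex: the average over [2 <= k] is in [U], and passing to the full average
   costs [O(1 / t)]. *)
Lemma average_Theta_le c r rt t l :
  0 <= c -> 0 <= r -> (forall k, (0 < k)%N -> enorm (u k) <= rt) ->
  (forall x y, U x -> eball rt x -> eball rt y ->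
    enorm (Theta y - Theta x) <= c * enorm (y - x)) ->
  dual_cone C l -> eball r l -> (0 < t)%N ->
  t%:R * dot l (Theta (average u t)) <=
    \sum_(1 <= k < t.+1) dot l (Theta (u k)) + 4 * (r * (c * rt)).
Proof.
move=> c0 r0 ub Tc lC lr.
have rt0 : 0 <= rt := le_trans (enorm_ge0 _) (ub 1%N isT).
have crt : 0 <= r * (c * rt) by rewrite !mulr_ge0.
case: t => // -[_|s _].
  rewrite /average !big_nat1 invr1 scale1r mul1r; lra.
set t := s.+2; pose w k := u k.+1; pose ubar := average w s.+1.
have Uw k : (0 < k)%N -> U (w k) by move=> k0; exact: u_dom.
have [Uub Jub] := jensen_average (t := s.+1) U_convex (dot_Theta_convex lC) Uw isT.
(* The zero function is a dummy: only membership of the average in the ball is wanted, here and just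
   below. *)
have [ubr _] := jensen_average (t := s.+1) (f := fun=> 0) (@eball_seg_closed n rt)
  (fun x y a _ _ _ => ltac:(by rewrite !mulr0 addr0)) (fun k _ => ub k.+1 isT) isT.
have [avr _] := jensen_average (t := t) (f := fun=> 0) (@eball_seg_closed n rt)
  (fun x y a _ _ _ => ltac:(by rewrite !mulr0 addr0)) ub isT.
rewrite -/w -/ubar in Uub Jub ubr.
have tn0 : t%:R != 0 :> R by rewrite pnatr_eq0.
(* Thus the two averages are O(1/t) apart, and multiplying by [t] costs only a constant. *)
have avE : t%:R *: (average u t - ubar) = u 1%N - ubar.
  rewrite scalerBr /average scalerA divff // scale1r big_ltn // big_add1 /=.
  rewrite -[\sum_(1 <= k < t) _](_ : s.+1%:R *: ubar = _); last first.
    by rewrite /ubar /average scalerA divff ?pnatr_eq0 // scale1r.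
  by rewrite /t -[s.+2%:R]natr1 scalerDl scale1r opprD addrA addrK.
have d2 : enorm (u 1%N - ubar) <= 2 * rt.
  apply: le_trans (ler_enormB _ _) _.
  by have := ub 1%N isT; have : enorm ubar <= rt := ubr; lra.
have h1 : t%:R * (dot l (Theta (average u t)) - dot l (Theta ubar)) <= 2 * (r * (c * rt)).
  have -> : dot l (Theta (average u t)) - dot l (Theta ubar) =
            dot l (Theta (average u t) - Theta ubar) by rewrite !dotE.
  rewrite -dotZr; apply: le_trans (dot_le_enorm _ _) _.
  rewrite mulrCA; apply: ler_pM; rewrite ?enorm_ge0 //.
  rewrite enormZ ger0_norm ?ler0n //.
  apply: (@le_trans _ _ (t%:R * (c * enorm (average u t - ubar)))).
    by rewrite ler_wpM2l ?ler0n // Tc.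
  rewrite mulrCA -[t%:R * _](_ : enorm (u 1%N - ubar) = _); last first.
    by rewrite -avE enormZ ger0_norm ?ler0n.
  by rewrite [leRHS]mulrCA ler_wpM2l.
(* Jensen on [s.+1] points leaves one spare copy of the value at [ubar], exchanged here for the
   missing term of [u 1]. *)
have h2 : dot l (Theta ubar) - dot l (Theta (u 1%N)) <= 2 * (r * (c * rt)).
  have -> : dot l (Theta ubar) - dot l (Theta (u 1%N)) =
            dot l (- (Theta (u 1%N) - Theta ubar)) by rewrite !dotE opprB addrC.
  apply: le_trans (dot_le_enorm _ _) _.
  rewrite mulrCA; apply: ler_pM; rewrite ?enorm_ge0 // enormN.
  apply: le_trans (Tc _ _ Uub ubr (ub _ _)) _ => //.
  by rewrite [leRHS]mulrCA ler_wpM2l.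
rewrite big_ltn // big_add1 /=.
have tE : t%:R = s.+1%:R + 1 :> R by rewrite natr1.
move: Jub h1 h2; rewrite /w tE /=.
move: (dot l (Theta (average u t))) (dot l (Theta ubar)) (dot l (Theta (u 1%N))) => A1 A2 A3.
move: (\sum_(_ <= _ < _) _) => S; lra.
Qed.

End Iteration.

(** * The convergence rate *)

(** The lower bound is the positive root of η^2 + η - 1; the second claim amounts to (2η + 1)^2 >=
    5. *)
Lemma golden_ratio_bounds (R : rcfType) (eta : R) :
  (Num.sqrt 5 - 1) / 2 <= eta -> 0 < eta /\ 0 <= eta ^+ 2 + eta - 1.
Proof.
have s2 : Num.sqrt 5 ^+ 2 = 5 :> R by rewrite sqr_sqrtr.
have s0 : 0 <= Num.sqrt 5 :> R by rewrite sqrtr_ge0.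
move: s2 s0; set s : R := Num.sqrt 5 => s2 s0 h.
have s1 : 1 < s by rewrite -ltr_sqr ?nnegrE // s2 expr1n ltr1n.
have e0 : 0 < eta by lra.
split=> //; have : s ^+ 2 <= (2 * eta + 1) ^+ 2 by rewrite ler_sqr ?nnegrE //; lra.
rewrite s2; lra.
Qed.

Lemma stepsize_bound (R : realFieldType) (alpha eta K : R) :
  0 < eta -> 0 < K -> 0 < alpha <= 1 / (2 * K * eta) -> K <= 1 / (2 * alpha) / eta.
Proof.
move=> e0 K0 /andP[a0 h].
have a2 : 0 < 2 * alpha by rewrite mulr_gt0.
rewrite ler_pdivlMr // ler_pdivlMr //.
have : 0 < 2 * K * eta by rewrite !mulr_gt0.
move=> d0; move: h; rewrite ler_pdivlMr //; lra.
Qed.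

(** The gap function presupposes bounded iterates: the first conjunct supplies a bound in the two
    cases addressed by the constraint qualification, and the second proves the rate for every valid
    bound [rt]. Finiteness of [J (u 1)] keeps the gap finite at [t = 1]. *)
Theorem theorem3 (R : realType) (n m : nat)
    (G : 'rV[R]_n -> 'rV[R]_n) (U : set 'rV[R]_n) (J : 'rV[R]_n -> \bar R)
    (Theta : 'rV[R]_n -> 'rV[R]_m) (C : set 'rV[R]_m) (O : set 'rV[R]_n)
    (L tau eta alpha gamma : R)
    (v u : nat -> 'rV[R]_n) (p q : nat -> 'rV[R]_m)
    (G_cont : continuous G)
    (U_closed : closed U) (U_convex : convex_set U)
    (J_fin : forall x, U x -> J x \is a fin_num)
    (J_cont : {within U, continuous J})
    (Theta_cont : continuous Theta)
    (C_neq0 : C !=set0) (C_closed : closed C) (C_convex : convex_set C)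
    (C_cone : is_cone C)
    (A1 : exists us, vip_solution U C G J Theta us)
    (L_ge0 : 0 <= L) (A2 : elipschitz U L G)
    (A3 : [/\ proper_fun J, econvex J & lower_semicontinuous J])
    (A4 : cone_convex U C Theta)
    (A5 : [/\ open O, U `<=` O & elipschitz O tau Theta])
    (A6 : constraint_qualification U C Theta)
    (eta_bounds : (Num.sqrt 5 - 1) / 2 <= eta < 1)
    (gamma_bounds : 0 < gamma < 1 / tau)
    (alpha_bounds : 0 < alpha <= 1 / (2 * (gamma * tau ^+ 2 + L + tau) * eta))
    (G_mono : monotone_on U G)
    (alavi : ALAVI U C G J Theta eta alpha gamma v u p q)
    (u1_dom : (J (u 1%N) < +oo)%E) :
  (interior C !=set0 \/ C = [set 0] ->
    exists rt : R, 0 < rt /\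
      forall k, (0 < k)%N -> wnorm (v k) (u k) (p k) <= rt) /\
  (forall rt : R, 0 < rt ->
    (forall k, (0 < k)%N -> wnorm (v k) (u k) (p k) <= rt) ->
    exists rho : R, 0 < rho /\
      forall t, (0 < t)%N ->
        (psi U C G J Theta ((2 * gamma * tau + 1) * rt)
             (average u t) (average q t) <= (rho / t%:R)%:E)%E).
Proof.
have cU := convex_set_seg U_convex; have cC := convex_set_seg C_convex.
have [J_proper J_convex _] := A3; have [oO UO Theta_lipO] := A5.
have [/golden_ratio_bounds[eta0 golden] eta1] := andP eta_bounds.
have eta01 : 0 < eta < 1 by rewrite eta0.
have [gamma0 gamma1] := andP gamma_bounds; have [alpha0 _] := andP alpha_bounds.
(* Positivity of [tau] is implicit in the range of [gamma]: division by 0 returns 0, leaving no room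
   for [gamma]. *)
have tau0 : 0 < tau by have := lt_trans gamma0 gamma1; rewrite mul1r invr_gt0.
have gt1 : gamma * tau < 1 by rewrite -ltr_pdivlMr.
have K0 : 0 < gamma * tau ^+ 2 + L + tau.
  by rewrite ltr_wpDl // addr_ge0 // mulr_ge0 ?exprn_ge0 // ltW.
have stepsize := stepsize_bound eta0 K0 alpha_bounds.
have Theta_lip : elipschitz U tau Theta.
  by move=> x y /UO Ox /UO Oy; exact: Theta_lipO.
split.
  move=> cq; have [us [[Uus Cus] usmin]] := A1.
  pose f x := dot (G us) (x - us) + fine (J x) - fine (J us).
  have cf : convex_on U f.
    move=> x y a Ux Uy a01; rewrite /f !dotE.
    have := fine_convex J_fin J_proper J_convex Ux Uy a01; lra.
  have fus : f us = 0 by rewrite /f subrr dot0r add0r subrr.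
  have fmin x : U x -> C (- Theta x) -> 0 <= f x.
    move=> Ux Cx; have := usmin _ (conj Ux Cx).
    by rewrite -(fineK (J_fin _ Ux)) -(fineK (J_fin _ Uus)) -EFinN -!EFinD lee_fin.
  have [ps [psC ps_ge0 ps0]] :=
    lagrange_multiplier cU cf cC C_cone A4 A6 cq Uus Cus fus fmin.
  apply: (iterates_bounded cU J_fin J_proper J_convex A4 L_ge0 A2 tau0 Theta_lip eta01
    golden gamma0 gt1 alpha0 stepsize G_mono alavi Uus psC) => k k1.
  (* The multiplier makes the part without [q k] nonnegative; the rest is [q k], in the dual cone,
     paired with [- Theta us], in [C]. *)
  have := ps_ge0 _ (u_dom alavi k1); rewrite /gap_term /f.
  have := q_dual alavi (ltnW k1) Cus; rewrite dotNr; lra.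
move=> rt rt0 wb; set r := (2 * gamma * tau + 1) * rt.
have r0 : 0 <= r by rewrite mulr_ge0 ?addr_ge0 ?mulr_ge0 // ltW.
have ub k : (0 < k)%N -> enorm (u k) <= rt.
  move=> /wb; apply: le_trans; rewrite -[leLHS]ger0_norm ?enorm_ge0 // -sqrtr_sqr.
  have a1 := sqr_ge0 (enorm (v k)); have a2 := sqr_ge0 (enorm (p k)).
  have a3 := sqr_ge0 (enorm (u k)).
  by rewrite ler_sqrt ?addr_ge0 //; lra.
have [c c0 Tc] := locally_lipschitz_on_compact rt U_closed oO UO Theta_cont (ltW tau0) Theta_lipO.
have [B gapB] := gap_sum_bounded cU J_fin J_proper J_convex A4 L_ge0 A2 tau0 Theta_lip eta01
  golden gamma0 gt1 alpha0 stepsize G_mono alavi r0.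
(* [B] bounds the summed gaps, the middle term pays for [u 1] possibly lying outside [U], and 1
   ensures positivity. *)
exists (`|B| + 4 * (r * (c * rt)) + 1).
have rct : 0 <= r * (c * rt) by rewrite mulr_ge0 // mulr_ge0 // ltW.
split; first by rewrite ltr_wpDl // addr_ge0 // mulr_ge0.
move=> t t0; have tR : 0 < t%:R :> R by rewrite ltr0n.
have Jdom k : (0 < k)%N -> J (u k) \is a fin_num.
  case: k => // -[_|k _]; first by rewrite fin_numElt J_proper.1.
  exact: J_fin (u_dom alavi _).
have [Jav Jsum] := jensen_average (dom_seg_closed J_proper J_convex)
  (fine_convex_dom J_proper J_convex) Jdom t0.
apply: ge_ereal_sup => _ [[z l] /= [[Uz zr] [lC lr]] <-].
rewrite /Psi -(fineK Jav) -(fineK (J_fin _ Uz)) -!EFinN -!EFinD lee_fin.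
rewrite ler_pdivlMr // mulrC.
have Tsum := average_Theta_le cU A4 alavi c0 r0 ub Tc lC lr t0.
have gsum := gapB _ _ _ t0 Uz zr lC lr.
have sumE (d : nat) (x : nat -> 'rV[R]_d) y :
    t%:R * dot (average x t) y = \sum_(1 <= k < t.+1) dot (x k) y.
  by rewrite -dotZl /average scalerA divff ?gt_eqF // scale1r dot_suml.
(* The gap is affine in the primal point except through [J] and [Theta], and affine in the
   multiplier: those parts average exactly, and only [Jsum] and [Tsum] are inequalities. *)
have gapE : \sum_(1 <= k < t.+1) @gap_term R n m G J Theta u q k z l =
    t%:R * dot (G z) (average u t - z) + \sum_(1 <= k < t.+1) fine (J (u k))
    - t%:R * fine (J z) + \sum_(1 <= k < t.+1) dot l (Theta (u k))
    - t%:R * dot (average q t) (Theta z).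
  have sumc (a : R) : t%:R * a = \sum_(1 <= k < t.+1) a.
    by rewrite sumr_const_nat subn1 /= mulr_natl.
  have -> : t%:R * dot (G z) (average u t - z) =
      \sum_(1 <= k < t.+1) dot (G z) (u k - z).
    rewrite dotDr mulrDr dotNr (dotC (G z) (average u t)) sumE sumc -big_split.
    by apply: eq_bigr => k _; rewrite dotDr dotNr (dotC (G z) (u k)).
  by rewrite sumE sumc -!sumrN -!big_split.
have := ler_norm B.
move: Jsum Tsum gsum; rewrite gapE; lra.
Qed.
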